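(* Let $G$ be a finite, simple, connected graph which is $3$-$\gamma_{c}$-critical. Then $\alpha(G) \leq \kappa(G) + 2$.
   Context: All graphs are finite, simple and connected. A set $D \subseteq V(G)$ is a connected dominating set of $G$ if every vertex of $G$ is in $D$ or adjacent to a vertex of $D$, and the induced subgraph $G[D]$ is connected; the connected domination number $\gamma_{c}(G)$ is the minimum size of such a set. For non-adjacent vertices $u,v$, $G+uv$ denotes $G$ with the edge $uv$ added. $G$ is $3$-$\gamma_{c}$-critical if $\gamma_{c}(G)=3$ and $\gamma_{c}(G+uv)<3$ for every pair of non-adjacent vertices $u,v$ of $G$. $\alpha(G)$ is the independence number (maximum size of a set of pairwise non-adjacent vertices), $\delta(G)$ the minimum degree, and $\kappa(G)$ the connectivity, i.e. the minimum size of a vertex cut set (a set $S$ of vertices with $G-S$ disconnected). *)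

(* Defs.v *)
From mathcomp Require Import all_boot.

Set Implicit Arguments.
Unset Strict Implicit.
Unset Printing Implicit Defensive.

(* A graph is its adjacency relation on a finite vertex type; simplicity is
   symmetry and irreflexivity of that relation. *)
Section Graph.
Variables (T : finType) (e : rel T).

Definition simple_graph := symmetric e /\ irreflexive e.

Definition induced (A : {set T}) : rel T := [rel x y in A | e x y].

(* Connectedness of the induced subgraph on A; vacuously true if A is empty,
   so that deleting every vertex does not count as disconnecting the graph. *)
Definition connected_on (A : {set T}) :=
  [forall x in A, forall y in A, connect (induced A) x y].

Definition connected_graph := connected_on [set: T].

Definition dominating (D : {set T}) :=
  [forall x, (x \in D) || [exists y in D, e x y]].

Definition connected_dominating (D : {set T}) :=
  dominating D && connected_on D.

(* The default [set: T] is itself a connected dominating set when the graph is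
   connected. *)
Definition gammac :=
  #|[arg min_(D < [set: T] | connected_dominating D) #|D|]|.

Definition add_edge (u v : T) : rel T :=
  [rel x y | [|| e x y, (x == u) && (y == v) | (x == v) && (y == u)]].

Definition independent (A : {set T}) := [forall x in A, forall y in A, ~~ e x y].

Definition alpha := \max_(A : {set T} | independent A) #|A|.

Definition vertex_cut (S : {set T}) := ~~ connected_on (~: S).

(* Complete graphs have no vertex cut; they get the usual value #|T| - 1. *)
Definition kappa :=
  if [pick S | vertex_cut S] is Some S0
  then #|[arg min_(S < S0 | vertex_cut S) #|S|]| else #|T|.-1.

End Graph.

Definition gammac_critical (k : nat) (T : finType) (e : rel T) :=
  gammac e = k /\
  forall u v : T, u != v -> ~~ e u v -> gammac (add_edge e u v) < k.

(* Main.v *)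
(* Let I be independent with at least three elements.  For distinct u, v in I,
   criticality yields, up to exchanging u and v, a vertex x such that {u, x} is
   connected and dominates exactly the vertices other than v; write u -> v.
   This makes I a semicomplete digraph, so it has a Hamiltonian path: every
   vertex u of I but the last one gets its own successor f u with u -> f u and
   a witness x u.  Within I the vertex x u is adjacent to everything but f u, so
   the pairs {u, x u} are pairwise disjoint.  If such a pair avoids a vertex cut
   S, then in G - S it is joined to everything but f u, so that S contains all
   the neighbors of f u.  A second pair avoiding S would contain or be adjacent
   to f u, hence would contain a neighbor of f u, which lies in S.  So S meets
   all pairs but one, and #|I| - 2 <= #|S|. *)
Require Import Defs.
From mathcomp Require Import all_boot.

Set Implicit Arguments.
Unset Strict Implicit.
Unset Printing Implicit Defensive.

Definition semicomplete_on (T : eqType) (pT : predType T) (A : pT)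
    (r : rel T) :=
  {in A &, forall u v, u != v -> r u v || r v u}.

(* Merge sort outputs a chain for any total relation, transitive or not. *)
Lemma semicomplete_hamiltonian_path (T : eqType) (r : rel T) (s : seq T) :
    uniq s -> semicomplete_on s r ->
  exists2 p, perm_eq p s & sorted r p.
Proof.
move=> s_uniq r_semi; pose r_eq := [rel u v | (u == v) || r u v].
exists (sort r_eq s); first by rewrite perm_sort.
have : sorted r_eq (sort r_eq s).
  apply: (@sort_sorted_in _ (mem s)); last exact/allP.
  move=> u v us vs /=; rewrite [v == u]eq_sym.
  by have [//|uv] := eqVneq u v; exact: r_semi.
have : uniq (sort r_eq s) by rewrite sort_uniq.
case: (sort r_eq s) => // a p; elim: p a => //= b p IHp a /andP[].
rewrite inE negb_or => /andP[/negPf-> _] p_uniq /andP[/= -> r_p].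
exact: IHp.
Qed.

Lemma path_next (T : eqType) (r : rel T) (a u : T) (p : seq T) :
    path r a p -> u \in a :: p -> u != last a p ->
  r u (next (a :: p) u).
Proof.
move=> r_p u_p /negPf u_last.
pose r_closed := [rel v w | (v == last a p) || r v w].
have : cycle r_closed (a :: p).
  rewrite /= rcons_path /= eqxx andbT.
  by apply: sub_path r_p => v w /= ->; rewrite orbT.
by move/next_cycle => /(_ u u_p) /=; rewrite u_last.
Qed.

Lemma semicomplete_successor (T : finType) (r : rel T) (I : {set T}) :
    0 < #|I| -> semicomplete_on I r ->
  exists2 a, a \in I &
    exists2 f, injective f & {in I :\ a, forall u, (f u \in I) && r u (f u)}.
Proof.
move=> I_gt0 r_semi.
have [||[|a p] p_perm r_p] := @semicomplete_hamiltonian_path _ r (enum I).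
- exact: enum_uniq.
- by move=> u v; rewrite !mem_enum; apply: r_semi.
- by move: I_gt0; rewrite cardE -(perm_size p_perm).
have p_mem u : (u \in a :: p) = (u \in I) by rewrite (perm_mem p_perm) mem_enum.
exists (last a p); first by rewrite -p_mem mem_last.
exists (next (a :: p)).
  by apply/can_inj/prev_next; rewrite (perm_uniq p_perm) enum_uniq.
move=> u; rewrite !inE -!p_mem mem_next => /andP[u_last u_p].
by rewrite u_p path_next.
Qed.

Lemma eq_set2 (T : finType) (A : {set T}) (x y : T) :
  x \in A -> y \in A -> x != y -> #|A| <= 2 -> A = [set x; y].
Proof.
move=> xA yA xy A_le2; apply/esym/eqP.
by rewrite eqEcard subUset !sub1set xA yA cards2 xy.
Qed.

Lemma ltn_card_notin (T : finType) (A B : {set T}) :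
  #|B| < #|A| -> exists2 x, x \in A & x \notin B.
Proof.
move=> BA; apply/subsetPn.
by apply: contraTN BA => /subset_leq_card; rewrite -leqNgt.
Qed.

Lemma leq_card_disjoint_meet (J T : finType) (A : {set J}) (D : J -> {set T})
    (S : {set T}) :
    {in A &, forall i j, i != j -> [disjoint D i & D j]} ->
    {in A, forall i, ~~ [disjoint D i & S]} ->
  #|A| <= #|S|.
Proof.
move=> D_disj D_meet; pose h i := [pick y in D i :&: S].
have h_meet i : i \in A -> exists2 y, h i = Some y & y \in D i :&: S.
  rewrite /h => /D_meet; rewrite -setI_eq0 => /set0Pn[z zDS].
  by case: pickP => [y|/(_ z)/negP//]; exists y.
have h_inj : {in A &, injective h}.
  move=> i j iA jA; have [y -> /setIP[yi _]] := h_meet i iA.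
  have [z -> /setIP[+ _] []] := h_meet j jA => /[swap] <- yj.
  apply/eqP; apply: contraTT yi => ij.
  by rewrite (disjointFl (D_disj i j iA jA ij)).
rewrite -(card_in_imset h_inj) -(card_imset S Some_inj); apply: subset_leq_card.
apply/subsetP => _ /imsetP[i iA ->]; have [y -> /setIP[_ yS]] := h_meet i iA.
exact: imset_f.
Qed.

Section ConnectedSets.
Variables (T : finType) (e : rel T).

Lemma connect_inducedS (A B : {set T}) :
  A \subset B -> subrel (connect (induced e A)) (connect (induced e B)).
Proof.
move=> /subsetP AB; apply: connect_sub => x y /= /andP[/andP[xA yA] xy].
by apply: connect1; rewrite /induced /= !AB.
Qed.

Lemma connected_onP (A : {set T}) :
  reflect {in A &, forall x y, connect (induced e A) x y} (connected_on e A).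
Proof.
apply: (iffP forall_inP) => [A_conn x y xA yA|A_conn x xA].
  by have /forall_inP := A_conn x xA; apply.
by apply/forall_inP => y yA; apply: A_conn.
Qed.

Lemma connected_on_root (A : {set T}) (u : T) :
    symmetric e -> {in A, forall z, connect (induced e A) u z} ->
  connected_on e A.
Proof.
move=> e_sym u_conn.
have c_sym : connect_sym (induced e A).
  apply: sym_connect_sym => x y.
  by rewrite /induced /= e_sym [X in X && _]andbC.
apply/connected_onP => x y xA yA.
by apply: connect_trans (u_conn y yA); rewrite c_sym u_conn.
Qed.

Lemma connected_on_neighbor (A : {set T}) (u w : T) :
    connected_on e A -> u \in A -> w \in A -> u != w ->
  exists2 y, y \in A :\ u & e u y.
Proof.
move=> /connected_onP A_conn uA wA uw.
have /connectP[p0 p0_path w_last] := A_conn u w uA wA.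
case: (shortenP p0_path) w_last => -[_ _ _ wu|y p].
  by rewrite wu eqxx in uw.
rewrite /= inE negb_or => /andP[/andP[/andP[_ yA] uy] _].
move=> /andP[/andP[y_neq_u _] _] _ _.
by exists y; rewrite // !inE eq_sym y_neq_u.
Qed.

Lemma eq_in_connected_on (e' : rel T) (A : {set T}) :
  {in A &, e =2 e'} -> connected_on e A = connected_on e' A.
Proof.
move=> ee'; have eq_ind : induced e A =2 induced e' A.
  by move=> x y; apply: andb_id2l => /andP[]; exact: ee'.
by apply: eq_forallb_in => x _; apply: eq_forallb_in => y _; exact: eq_connect.
Qed.

End ConnectedSets.

Section Domination.
Variables (T : finType) (e : rel T).

Definition closed_neighborhood (D : {set T}) :=
  [set z | (z \in D) || [exists y in D, e z y]].

Definition connected_dominates_but (D : {set T}) (v : T) :=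
  connected_on e D && (closed_neighborhood D == [set~ v]).

Lemma closed_neighborhoodP (D : {set T}) (z : T) :
  reflect (exists2 y, y \in D & (z == y) || e z y)
    (z \in closed_neighborhood D).
Proof.
rewrite inE; apply: (iffP orP) => [[]|[y yD /orP[/eqP->|zy]]].
- by exists z; rewrite ?eqxx.
- by case/exists_inP=> y yD zy; exists y; rewrite // zy orbT.
- by left.
- by right; apply/exists_inP; exists y.
Qed.

Lemma dominatingE (D : {set T}) :
  dominating e D = (closed_neighborhood D == [set: T]).
Proof.
by rewrite -subTset; apply/forallP/subsetP => D_dom z; have := D_dom z;
  rewrite !inE //; apply.
Qed.

Lemma connected_dominates_butP (D : {set T}) (v z : T) :
    connected_dominates_but D v ->
  reflect (exists2 y, y \in D & (z == y) || e z y) (z != v).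
Proof.
case/andP=> _ /eqP D_nbhd; rewrite -in_setC1 -D_nbhd.
exact: closed_neighborhoodP.
Qed.

Lemma gammac_ltP (k : nat) :
    connected_graph e ->
  reflect (exists2 D, connected_dominating e D & #|D| < k) (gammac e < k).
Proof.
move=> G_conn; rewrite /gammac; case: arg_minnP => [|M M_dom M_min].
  by apply/andP; split=> //; apply/forallP => z; rewrite inE.
apply: (iffP idP) => [|[D D_dom]]; first by exists M.
exact/leq_ltn_trans/M_min.
Qed.

Lemma connected_dominates_but_eq_off (e' : rel T) (D : {set T}) (v : T) :
    {in [set~ v] &, e =2 e'} -> v \notin D ->
    connected_dominating e' D -> ~~ connected_dominating e D ->
  connected_dominates_but D v.
Proof.
move=> ee' vD /andP[/forallP D_dom D_conn].
have D_off y : y \in D -> y \in [set~ v].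
  by rewrite in_setC1; apply: contraTneq => ->.
have {D_conn} D_conn : connected_on e D.
  rewrite (eq_in_connected_on (e' := e')) // => x y /D_off xv /D_off.
  exact: ee'.
have D_nbhd z : z \in [set~ v] -> z \in closed_neighborhood D.
  move=> zv; apply/closed_neighborhoodP.
  have /orP[zD|/exists_inP[y yD zy]] := D_dom z.
    by exists z; rewrite ?eqxx.
  by exists y => //; rewrite ee' ?zy ?orbT // D_off.
rewrite /connected_dominating D_conn andbT dominatingE -subTset.
case/subsetPn=> w _ w_far.
have {w_far} v_far : v \notin closed_neighborhood D.
  suff <- : w = v by [].
  by apply/eqP; apply: contraNT w_far => wv; rewrite D_nbhd ?in_setC1.
rewrite /connected_dominates_but D_conn; apply/eqP/setP => z.
apply/idP/idP; last exact: D_nbhd.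
by rewrite in_setC1; apply: contraTneq => ->.
Qed.

End Domination.

Section VertexCuts.
Variables (T : finType) (e : rel T).
Hypotheses (e_sym : symmetric e) (e_irr : irreflexive e).

(* Everything in G - S but v is in the component of D, so an edge from v into
   G - S would connect G - S. *)
Lemma vertex_cut_neighborhood (S D : {set T}) (v z : T) :
    vertex_cut e S -> connected_dominates_but e D v -> 0 < #|D| ->
    [disjoint D & S] -> e v z ->
  z \in S.
Proof.
move=> S_cut D_but /card_gt0P[u uD] DS vz.
have DcS : D \subset ~: S by rewrite subsets_disjoint setCK.
pose c := connect (induced e (~: S)).
have c_edge x y : x \in ~: S -> y \in ~: S -> e x y -> c x y.
  by move=> xS yS xy; apply: connect1; rewrite /induced /= xS yS.
have u_conn w : w \in ~: S -> w != v -> c u w.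
  move=> wS /(connected_dominates_butP _ D_but)[y yD].
  have uy : c u y.
    apply: (connect_inducedS DcS).
    by case/andP: D_but => /connected_onP D_conn _; apply: D_conn.
  case/orP => [/eqP->//|wy]; apply: connect_trans uy _.
  by apply: c_edge (subsetP DcS y yD) wS _; rewrite e_sym.
apply: contraNT S_cut; rewrite -in_setC => zS.
apply: (connected_on_root e_sym (u := u)) => w wS.
have [wv|] := eqVneq w v; last exact: u_conn.
have zv : z != v by apply: contraTneq vz => ->; rewrite e_irr.
apply: connect_trans (u_conn z zS zv) _.
by apply: c_edge zS wS _; rewrite wv e_sym.
Qed.

Lemma vertex_cut_disjoint_unique (S D D' : {set T}) (v v' : T) :
    vertex_cut e S ->
    connected_dominates_but e D v -> 0 < #|D| -> [disjoint D & S] ->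
    connected_dominates_but e D' v' -> 1 < #|D'| -> [disjoint D' & S] ->
  v = v'.
Proof.
move=> S_cut D_but D_gt0 DS D'_but D'_gt1 D'S.
have v_isolated y : y \in D' -> ~~ e v y.
  move=> yD'; apply: contraFN (disjointFr D'S yD').
  exact: vertex_cut_neighborhood D_but D_gt0 DS.
apply/eqP; apply: contraT => /(connected_dominates_butP _ D'_but)[y yD'].
rewrite (negPf (v_isolated y yD')) orbF => /eqP vy.
have [|w wD'] := @ltn_card_notin _ D' [set v]; first by rewrite cards1.
rewrite inE eq_sym => wv.
rewrite -{}vy in yD'; have /andP[D'_conn _] := D'_but.
have [x /setD1P[_ xD'] vx] := connected_on_neighbor D'_conn yD' wD' wv.
by have := v_isolated x xD'; rewrite vx.
Qed.

End VertexCuts.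

Section AddEdge.
Variables (T : finType) (e : rel T).

Lemma add_edge_connected u v :
  connected_graph e -> connected_graph (add_edge e u v).
Proof.
move=> /connected_onP G_conn; apply/connected_onP => x y xT yT.
apply: connect_sub (G_conn x y xT yT) => {xT yT} {}x {}y /andP[xyT xy].
by apply: connect1; rewrite /induced /add_edge /= xyT xy.
Qed.

Lemma add_edge_off u v w :
  w \in [set u; v] -> {in [set~ w] &, e =2 add_edge e u v}.
Proof.
move=> uvw x y; rewrite !inE /add_edge /= => xw yw.
by case/set2P: uvw xw yw => -> /negPf-> /negPf->; rewrite ?(andbF, andFb, orbF).
Qed.

Lemma gammac_critical_add_edge (k : nat) (u v : T) :
    connected_graph e -> gammac_critical k e -> u != v -> ~~ e u v ->
  exists D, [/\ connected_dominating (add_edge e u v) D, #|D| < k &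
    forall w, w \in [set u; v] -> w \notin D -> connected_dominates_but e D w].
Proof.
move=> G_conn [gammac_k G_add] uv e_uv.
have [D D_dom D_lt] :=
  gammac_ltP k (add_edge_connected u v G_conn) (G_add u v uv e_uv).
have D_ndom : ~~ connected_dominating e D.
  apply/negP => De; suff : gammac e < k by rewrite gammac_k ltnn.
  by apply/(gammac_ltP k G_conn); exists D.
exists D; split=> // w uvw wD.
by apply: connected_dominates_but_eq_off wD D_dom D_ndom; apply: add_edge_off.
Qed.

End AddEdge.

Section Arrows.
Variables (T : finType) (e : rel T).

Definition arrow_witness (u v x : T) :=
  (x != u) && connected_dominates_but e [set u; x] v.

Definition arrow (u v : T) := [exists x, arrow_witness u v x].

Variable I : {set T}.
Hypothesis I_indep : independent e I.

Lemma independent_nonadj : {in I &, forall u v, ~~ e u v}.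
Proof. by move=> u v /(forall_inP I_indep)/forall_inP; apply. Qed.

Lemma connected_dominates_but_arrow (D : {set T}) (u v : T) :
    2 < #|I| -> u \in I -> u \in D -> #|D| <= 2 ->
    connected_dominates_but e D v ->
  arrow u v.
Proof.
move=> I_gt2 uI uD D_le2 D_but.
have [|t tI] := @ltn_card_notin _ I [set u; v].
  by apply: leq_ltn_trans I_gt2; rewrite cards2; case: eqP.
rewrite !inE negb_or => /andP[tu tv].
have [x xD tx] := connected_dominates_butP _ D_but tv.
have xu : x != u.
  by apply: contraTneq tx => ->; rewrite (negPf tu) independent_nonadj.
apply/existsP; exists x; rewrite /arrow_witness xu.
by rewrite -(eq_set2 uD xD) // eq_sym.
Qed.

Lemma arrow_witness_adj u v x : arrow_witness u v x -> e u x.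
Proof.
case/andP=> xu /andP[ux_conn _].
have [|y] := connected_on_neighbor ux_conn (set21 u x) (set22 u x).
  by rewrite eq_sym.
by rewrite !inE => /andP[/negPf-> /eqP->].
Qed.

Lemma arrow_witness_notin u v x : u \in I -> arrow_witness u v x -> x \notin I.
Proof.
by move=> uI /arrow_witness_adj; apply: contraTN; apply: independent_nonadj.
Qed.

Lemma arrow_witness_adjE u v x b :
  u \in I -> arrow_witness u v x -> b \in I -> e b x = (b != v).
Proof.
move=> uI ux bI; have /andP[_ ux_but] := ux.
apply/idP/(connected_dominates_butP b ux_but) => [bx|[y /set2P[]->]].
- by exists x; rewrite ?set22 // bx orbT.
- rewrite (negPf (independent_nonadj bI uI)) orbF => /eqP->.
  exact: arrow_witness_adj ux.
- by case/orP=> // /eqP bx; have := arrow_witness_notin uI ux; rewrite -bx bI.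
Qed.

Lemma arrow_pairs_disjoint u v x u' v' x' :
    u \in I -> v \in I -> arrow_witness u v x ->
    u' \in I -> arrow_witness u' v' x' -> u != u' -> v != v' ->
  [disjoint [set u; x] & [set u'; x']].
Proof.
move=> uI vI ux u'I u'x' uu' vv'.
have xx' : x != x'.
  apply: contraNneq vv' => xx'.
  by have := arrow_witness_adjE u'I u'x' vI;
    rewrite -xx' (arrow_witness_adjE uI ux vI) eqxx => /esym/negbFE.
have xI := arrow_witness_notin uI ux; have x'I := arrow_witness_notin u'I u'x'.
rewrite -setI_eq0; apply: contraT => /set0Pn[z /setIP[/set2P[]-> /set2P[] E]].
- by rewrite E eqxx in uu'.
- by rewrite -E uI in x'I.
- by rewrite E u'I in xI.
- by rewrite E eqxx in xx'.
Qed.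

End Arrows.

Section Critical.
Variables (T : finType) (e : rel T).
Hypotheses (e_sym : symmetric e) (e_irr : irreflexive e).
Hypotheses (G_conn : connected_graph e) (G_crit : gammac_critical 3 e).
Variable I : {set T}.
Hypotheses (I_indep : independent e I) (I_gt2 : 2 < #|I|).

Lemma arrow_semicomplete : semicomplete_on I (arrow e).
Proof.
move=> u v uI vI uv.
have [D [D_dom D_le2 D_but]] :=
  gammac_critical_add_edge G_conn G_crit uv (independent_nonadj I_indep uI vI).
have [uD|/(D_but _ (set21 _ _)) u_but] := boolP (u \in D);
  have [vD|/(D_but _ (set22 _ _)) v_but] := boolP (v \in D).
- have [|t tI] := @ltn_card_notin _ I D.
    exact: leq_ltn_trans I_gt2.
  rewrite (eq_set2 uD vD uv D_le2) !inE negb_or => /andP[/negPf tu /negPf tv].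
  case/andP: D_dom => /forallP/(_ t).
  rewrite (eq_set2 uD vD uv D_le2) !inE tu tv => /exists_inP[y].
  rewrite !inE /add_edge /= tu tv orbF.
  by case/orP=> /eqP->; rewrite (negPf (independent_nonadj I_indep _ _)).
- by rewrite (connected_dominates_but_arrow I_indep I_gt2 uI uD).
- by rewrite orbC (connected_dominates_but_arrow I_indep I_gt2 vI vD).
- case/andP: u_but v_but => _ /eqP u_nbhd /andP[_]; rewrite u_nbhd.
  by move/eqP/setC_inj/set1_inj/eqP; rewrite (negPf uv).
Qed.

Lemma arrow_successor :
  exists2 a, a \in I & exists2 f, injective f & exists x : T -> T,
    {in I :\ a, forall u, f u \in I /\ arrow_witness e u (f u) (x u)}.
Proof.
have I_gt0 : 0 < #|I| := leq_trans (isT : 0 < 3) I_gt2.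
have [a aI [f f_inj f_arrow]] :=
  semicomplete_successor I_gt0 arrow_semicomplete.
exists a => //; exists f => //.
have /fin_all_exists[x xP] (u : T) :
    exists x, u \in I :\ a -> f u \in I /\ arrow_witness e u (f u) x.
  have [uA|] := boolP (u \in I :\ a); last by exists u.
  by have /andP[fuI /existsP[x ux]] := f_arrow u uA; exists x.
by exists x.
Qed.

Lemma independent_le_vertex_cut (S : {set T}) :
  vertex_cut e S -> #|I| <= #|S| + 2.
Proof.
move=> S_cut; have [a aI [f f_inj [x xP]]] := arrow_successor.
pose D u := [set u; x u].
have D_gt1 u : u \in I :\ a -> 1 < #|D u|.
  by move=> /xP[_ /andP[xu _]]; rewrite cards2 eq_sym xu.
have D_disj : {in I :\ a &, forall u u', u != u' -> [disjoint D u & D u']}.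
  move=> u u' uA u'A uu'; have [[_ uI] [_ u'I]] := (setD1P uA, setD1P u'A).
  have [[fuI ux] [_ u'x']] := (xP u uA, xP u' u'A).
  apply: (arrow_pairs_disjoint I_indep uI fuI ux u'I u'x' uu').
  by rewrite (inj_eq f_inj).
pose B := [set u | [disjoint D u & S]].
have AB_le1 : #|(I :\ a) :&: B| <= 1.
  apply/card_le1_eqP => u' u /setIP[u'A + /setIP[uA]].
  rewrite !inE => u'S uS; apply: f_inj.
  have [[_ /andP[_ u_but]] [_ /andP[_ u'_but]]] := (xP u uA, xP u' u'A).
  have [D_gt0 D'_gt1] := (ltnW (D_gt1 u uA), D_gt1 u' u'A).
  exact: (vertex_cut_disjoint_unique e_sym e_irr S_cut u_but D_gt0 uS u'_but).
have AnB_le : #|(I :\ a) :\: B| <= #|S|.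
  apply: (leq_card_disjoint_meet (D := D)) => [u u'|u].
    by move=> /setDP[uA _] /setDP[u'A _]; exact: D_disj.
  by case/setDP=> _; rewrite inE.
by rewrite (cardsD1 a) aI -(cardsID B (I :\ a)) addnA addnC leq_add.
Qed.

End Critical.

Theorem theorem3p2 (T : finType) (e : rel T) :
  simple_graph e -> connected_graph e -> gammac_critical 3 e ->
  alpha e <= kappa e + 2.
Proof.
move=> [e_sym e_irr] G_conn G_crit; apply/bigmax_leqP => I I_indep.
rewrite /kappa; case: pickP => [S0 S0_cut|_].
  case: arg_minnP => // S S_cut _; have [I_le2|I_gt2] := leqP #|I| 2.
    by rewrite (leq_trans I_le2) // leq_addl.
  exact: independent_le_vertex_cut.
by rewrite addn2 (leq_trans (max_card _)) // ltnW // ltnS leqSpred.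
Qed.
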